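(* For every Urysohn space $X$ we have $|X|\le wL(X)^{s\Delta_2(X)\cdot \mathrm{dot}(X)}$.
   Context: All spaces are topological $T_1$-spaces; a space is Urysohn if any two distinct points have neighborhoods with disjoint closures. For a family $\mathcal{U}$ of subsets of $X$ and $G\subset X$ put $\mathrm{st}(G,\mathcal{U})=\bigcup\{U\in\mathcal{U}:U\cap G\ne\emptyset\}$, $\mathrm{st}^0(G,\mathcal{U})=G$, $\mathrm{st}^n(G,\mathcal{U})=\mathrm{st}(\mathrm{st}^{n-1}(G,\mathcal{U}),\mathcal{U})$, and $\mathrm{st}^n(x,\mathcal{U})=\mathrm{st}^n(\{x\},\mathcal{U})$. - $wL(X)$ (weak Lindelöf number) is the smallest infinite cardinal $\kappa$ such that every open cover of $X$ has a subcollection of cardinality $\le\kappa$ whose union is dense in $X$. - $s\Delta_2(X)$ is the minimal infinite cardinal $\kappa$ for which there is a family $\{\mathcal{U}_\alpha:\alpha<\kappa\}$ of open covers of $X$ such that for any distinct points $x,y\in X$ we have $y\notin\overline{\mathrm{st}^2(x,\mathcal{U}_\alpha)}$ for some $\alpha<\kappa$. - $\mathrm{dot}(X)$ (dense o-tightness) is the smallest infinite cardinal $\kappa$ such that for every family $\mathcal{U}$ of open subsets of $X$ whose union is dense in $X$ and every point $x\in X$ there is a subfamily $\mathcal{V}\subset\mathcal{U}$ with $|\mathcal{V}|\le\kappa$ and $x\in\overline{\bigcup\mathcal{V}}$. *)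

(* Defs.v *)
From HB Require Import structures.
From mathcomp Require Import all_boot all_order.
From mathcomp Require Import boolp classical_sets functions cardinality.
From mathcomp Require Import filter topology.

Set Implicit Arguments.
Unset Strict Implicit.
Unset Printing Implicit Defensive.

Local Open Scope classical_set_scope.
Local Open Scope card_scope.

(* The library has no type of cardinals: a cardinal is represented here by any
   type K of that cardinality, |K| <= |L| is [set: K] #<= [set: L], the product
   of cardinals is K * L, and the power K ^ L is the function type L -> K. *)

Definition is_least_infinite_cardinal (P : Type -> Prop) (K : Type) : Prop :=
  [/\ infinite_set [set: K], P K &
      forall L : Type, infinite_set [set: L] -> P L -> [set: K] #<= [set: L]].

(* The value nat is junk, taken only when no infinite cardinal satisfies P; see
   wLP, sDelta2P and dotP, which show that this does not occur for the
   invariants below. *)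
Definition least_infinite_cardinal (P : Type -> Prop) : Type :=
  if pselect (exists K, is_least_infinite_cardinal P K) is left e
  then sval (cid e) else nat.

Section Invariants.
Variable X : topologicalType.
Implicit Types (U V : set (set X)) (G : set X) (K : Type).

Definition urysohn_space : Prop :=
  forall x y : X, x != y -> exists A B : set X,
    [/\ nbhs x A, nbhs y B & closure A `&` closure B = set0].

Definition open_family U : Prop := forall O, U O -> open O.

Definition is_open_cover U : Prop :=
  open_family U /\ \bigcup_(O in U) O = [set: X].

Definition star G U : set X := \bigcup_(O in [set O | U O /\ O `&` G !=set0]) O.

Definition iter_star (n : nat) G U : set X := iter n (star ^~ U) G.

Definition wL_bound K : Prop :=
  forall U, is_open_cover U ->
  exists V, [/\ V `<=` U, V #<= [set: K] & dense (\bigcup_(O in V) O)].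

Definition sDelta2_bound K : Prop :=
  exists F : K -> set (set X), (forall a, is_open_cover (F a)) /\
    forall x y : X, x != y -> exists a, ~ closure (iter_star 2 [set x] (F a)) y.

Definition dot_bound K : Prop :=
  forall U, open_family U -> dense (\bigcup_(O in U) O) ->
  forall x : X, exists V,
    [/\ V `<=` U, V #<= [set: K] & closure (\bigcup_(O in V) O) x].

Definition wL : Type := least_infinite_cardinal wL_bound.
Definition sDelta2 : Type := least_infinite_cardinal sDelta2_bound.
Definition dot : Type := least_infinite_cardinal dot_bound.

End Invariants.

Section LeastCardinals.

Lemma inj_card_leT (A B : Type) (f : A -> B) :
  injective f -> [set: A] #<= [set: B].
Proof.
move=> fI; elim/Ppointed: B => B in f fI *.
  have A0 : [set: A] = set0 by rewrite -subset0 => a _; exact: no (f a).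
  by rewrite A0; exact: card_ge0.
by apply/pcard_injP; exists f => x y _ _ /fI.
Qed.

Lemma card_leT_inj (A B : Type) :
  [set: A] #<= [set: B] -> exists f : A -> B, injective f.
Proof.
move=> /card_leP[f]; exists (fun a => val (f (SigSub (mem_set (Logic.I : [set: A] a))))).
move=> x y /val_inj /(@inj _ _ _ f); rewrite !inE => /(_ I I) e.
by case: e.
Qed.

Lemma family_least_cardinal (I : Type) (i0 : I) (F : I -> Type) :
  exists i, forall j, [set: F i] #<= [set: F j].
Proof.
pose sep (A : set (forall i, F i)) :=
  forall f g i, A f -> A g -> f i = g i -> f = g.
have [C Csep Ctot|A [Asep Amax]] := @Zorn_bigcup _ sep.
  move=> f g i [S CS Sf] [T CT Tg].
  have [/(_ _ Sf) Tf|/(_ _ Tg) Sg] := Ctot _ _ CS CT.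
    exact: (Csep _ CT).
  exact: (Csep _ CS).
suff [i Fi] : exists i, forall y : F i, exists2 f, A f & f i = y.
  exists i => j; pose h y := s2val (cid2 (Fi y)).
  apply: (@inj_card_leT _ _ (fun y => h y j)) => y z.
  rewrite /h; case: (cid2 (Fi y)) => f Af /= <-.
  by case: (cid2 (Fi z)) => g Ag /= <- /(Asep _ _ _ Af Ag) ->.
apply: contrapT => /forallNP noi.
have {}noi i : exists y : F i, forall f, A f -> f i <> y.
  have /existsNP[y Ny] := noi i.
  by exists y => f Af fy; apply: Ny; exists f.
pose h i := sval (cid (noi i)).
have hA f i : A f -> f i <> h i by rewrite /h; case: cid => y /= /[apply].
apply: (Amax (A `|` [set h])).
  split=> [f Af|hs]; first by left.
  by apply: (hA h i0 (hs _ _) erefl); right.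
move=> f g i [Af|->] [Ag|->] //; first exact: Asep.
- by move/hA => /(_ Af).
- by move/esym/hA => /(_ Ag).
Qed.

Lemma card_leT_total (A B : Type) :
  [set: A] #<= [set: B] \/ [set: B] #<= [set: A].
Proof.
have [[] h] := family_least_cardinal true (fun b : bool => if b then A else B).
- by left; exact: (h false).
- by right; exact: (h true).
Qed.

Lemma least_infinite_cardinalP (P : Type -> Prop) (K0 : Type) :
  (forall K L, [set: K] #<= [set: L] -> infinite_set [set: K] -> P K -> P L) ->
  infinite_set [set: K0] -> P K0 ->
  is_least_infinite_cardinal P (least_infinite_cardinal P).
Proof.
move=> Pmono K0inf PK0; rewrite /least_infinite_cardinal.
case: pselect => [e|]; first by case: (cid e).
case; pose I := {S : set K0 | infinite_set [set: {x | S x}] /\ P {x | S x}}.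
have sub (L : Type) (f : L -> K0) (fI : injective f) :
    infinite_set [set: L] -> P L ->
    exists i : I, [set: {x | sval i x}] #<= [set: L].
  move=> Linf PL; pose S := range f.
  have LS : [set: L] #<= [set: {x | S x}].
    apply: (@inj_card_leT _ _
      (fun l => exist S (f l) (ex_intro2 _ _ l Logic.I erefl))).
    by move=> x y [] /fI.
  have Si : infinite_set [set: {x | S x}].
    by move=> Sf; apply: Linf; exact: card_le_finite LS Sf.
  exists (exist _ S (conj Si (Pmono _ _ LS Linf PL))) => /=.
  pose g (s : {x | S x}) := s2val (cid2 (svalP s)).
  have gK s : f (g s) = sval s by exact: s2valP' (cid2 (svalP s)).
  apply: (@inj_card_leT _ _ g) => s t gst.
  by apply: eq_sig_hprop => [x|]; [exact: Prop_irrelevance|rewrite -!gK gst].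
have [i0 _] := sub K0 id (@inj_id _) K0inf PK0.
have [i imin] := family_least_cardinal i0 (fun i : I => {x | sval i x}).
exists {x | sval i x}; have [iinf Pi] := svalP i; split => // L Linf PL.
have [LK0|K0L] := card_leT_total L K0.
  have [f fI] := card_leT_inj LK0.
  have [j jL] := sub L f fI Linf PL.
  exact: card_le_trans (imin j) jL.
apply: card_le_trans K0L; apply: (@inj_card_leT _ _ sval) => s t.
by apply: eq_sig_hprop => x; exact: Prop_irrelevance.
Qed.

Lemma infinite_sum_nat (T : Type) : infinite_set [set: T + nat].
Proof.
by apply/infiniteP; apply: (@inj_card_leT _ _ (@inr T nat)) => x y [].
Qed.

Variable X : topologicalType.

Lemma wLP : is_least_infinite_cardinal (@wL_bound X) (wL X).
Proof.
apply: (@least_infinite_cardinalP _ (set X + nat)) => [K L KL _ wK U /wK| |].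
- by move=> [V [VU VK Vd]]; exists V; split=> //; exact: card_le_trans KL.
- exact: infinite_sum_nat.
move=> U [Uo Uc]; exists U; split=> // [|O [x Ox] _]; last first.
  by rewrite Uc; exists x.
apply: card_le_trans (card_leT U) _.
by apply: (@inj_card_leT _ _ inl) => x y [].
Qed.

Lemma dotP : is_least_infinite_cardinal (@dot_bound X) (dot X).
Proof.
apply: (@least_infinite_cardinalP _ (set X + nat)) => [K L KL _ wK U Uo Ud x| |].
- have [V [VU VK Vx]] := wK U Uo Ud x.
  by exists V; split=> //; exact: card_le_trans KL.
- exact: infinite_sum_nat.
move=> U Uo Ud x; exists U; split=> //.
  apply: card_le_trans (card_leT U) _.
  by apply: (@inj_card_leT _ _ inl) => y z [].
move=> B; rewrite nbhsE => -[O [Oo Ox] OB].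
have [z [Oz Uz]] := Ud O (ex_intro _ x Ox) Oo.
by exists z; split => //; exact: OB.
Qed.

Lemma sDelta2P : accessible_space X -> urysohn_space X ->
  is_least_infinite_cardinal (@sDelta2_bound X) (sDelta2 X).
Proof.
move=> X1 XU; pose K0 : Type := (X * X + nat)%type.
apply: (@least_infinite_cardinalP _ K0) => [K L KL Kinf [F [Fc Fs]]| |].
- have [k0 _] : [set: K] !=set0.
    by apply/set0P/eqP => K0e; apply: Kinf; rewrite K0e; exact: finite_set0.
  have [f fI] := card_leT_inj KL.
  pose g l := if pselect (exists k, f k = l) is left e then sval (cid e) else k0.
  have fK k : g (f k) = k.
    rewrite /g; case: pselect => [e|[]]; last by exists k.
    by case: (cid e) => k' /= /fI.
  exists (F \o g); split=> [a|x y /Fs[a Fa]]; first exact: Fc.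
  by exists (f a); rewrite /= fK.
- exact: infinite_sum_nat.
have single (x y : X) : x != y -> exists U : set (set X), is_open_cover U /\
    ~ closure (iter_star 2 [set x] U) y.
  move=> xy; have [A [B [xA yB AB0]]] := XU _ _ xy.
  pose O1 := A°%classic; pose O2 := ~` closure B `&` ~` [set x].
  pose O3 := ~` closure A.
  have O1o : open O1 by exact: open_interior.
  have O1A : O1 `<=` closure A.
    exact: subset_trans (@interior_subset _ A) (@subset_closure _ A).
  have O2o : open O2.
    apply: openI; apply: closed_openC; first exact: closed_closure.
    exact: accessible_closed_set1.
  have O3o : open O3 by apply: closed_openC; exact: closed_closure.
  have AB z : closure A z -> ~ closure B z.
    by move=> Az Bz; have : set0 z by rewrite -AB0.
  exists [set O | O = O1 \/ (O = O2 \/ O = O3)]; split.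
    split=> [O [->|[->|->]]//|]; rewrite -subTset => z _.
    have [->|/eqP zx] := eqVneq z x; first by exists O1; [left|].
    have [Az|Az] := pselect (closure A z).
      by exists O2; [right; left|split => //; exact: AB].
    by exists O3; [right; right|].
  have st1 : star [set x] [set O | O = O1 \/ (O = O2 \/ O = O3)] `<=` O1.
    move=> z [O /= [UO [w [Ow wx]]] Oz]; rewrite {}wx in Ow.
    case: UO => [<-//|[OE|OE]]; move: Ow; rewrite OE.
      by move=> [_]; case.
    by case; exact: subset_closure (nbhs_singleton xA).
  have st2 : iter_star 2 [set x] [set O | O = O1 \/ (O = O2 \/ O = O3)]
      `<=` ~` closure B.
    move=> z [O /= [[->|[->|->]] [w [Ow /st1 wO1]]]].
    - by move=> /O1A /AB.
    - by move=> [nB _].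
    - by case: Ow; exact: O1A.
  move=> /(_ B yB)[w [/st2 nB Bw]]; apply: nB; exact: subset_closure.
pose F0 : set (set X) := [set setT].
have F0c : is_open_cover F0.
  split=> [O ->|]; first exact: openT.
  by rewrite -subTset => z _; exists setT.
pose F (k : K0) : set (set X) := if k is inl (x, y) then
  (if pselect (exists U, is_open_cover U /\ ~ closure (iter_star 2 [set x] U) y)
   is left e then sval (cid e) else F0) else F0.
exists F; split=> [[[x y]|n]|x y xy] //=.
  by case: pselect => // e; case: (cid e) => U [].
exists (inl (x, y)) => /=; case: pselect => [e|[]]; last exact: single.
by case: (cid e) => U [].
Qed.

End LeastCardinals.

(* Main.v *)
Require Import Defs.
From mathcomp Require Import all_boot all_order.
From mathcomp Require Import boolp classical_sets functions cardinality.
From mathcomp Require Import filter topology.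

Local Open Scope classical_set_scope.
Local Open Scope card_scope.

(** Let [U_a], for [a] in [K := sDelta2 X], be open covers witnessing the value
    of [sDelta2 X], and let [V_a] be a subfamily of [U_a] with dense union,
    enumerated by [s_a : wL X -> set X].  Given a point [x], dense o-tightness
    yields a subfamily of [V_a] of size at most [dot X] whose union has [x] in
    its closure.  Members that miss the open neighbourhood [st (x, U_a)] of [x]
    may be discarded, so that [x] lies in the closure of the union while the
    union is contained in [st^2 (x, U_a)] (lemma [dot_near_star]).  Reading this
    family through [s_a] gives, for each [a], a function [dot X -> wL X], hence
    altogether a code of [x] in [sDelta2 X * dot X -> wL X].  If [x] and [y]
    have the same code, then for every [a] the point [y] is in the closure of
    [st^2 (x, U_a)], and so [y = x].  The argument uses only that the three
    cardinals bound the respective invariants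
    (lemma [card_le_star_separation]). *)

Lemma card_le_range (T L : Type) (W : set T) :
  W !=set0 -> W #<= [set: L] -> exists g : L -> T, range g = W.
Proof.
move=> /set0P/eqP W0 /pfcard_geP[//|/surjfunPex[g ->]].
by exists g.
Qed.

Lemma closure_nonempty (X : topologicalType) (A : set X) (x : X) :
  closure A x -> A !=set0.
Proof. by move=> /(_ _ filterT); rewrite setIT. Qed.

Lemma open_star (X : topologicalType) (G : set X) (U : set (set X)) :
  open_family U -> open (star G U).
Proof. by move=> Uo; apply: bigcup_open => O [/Uo]. Qed.

Lemma star_point (X : topologicalType) (U : set (set X)) (x : X) :
  is_open_cover U -> star [set x] U x.
Proof.
move=> [_ Uc]; have : [set: X] x by [].
by rewrite -Uc => -[O UO Ox]; exists O => //; split=> //; exists x.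
Qed.

(** The family provided by dense o-tightness can be chosen inside the second
    star of the point; it is given by an enumeration, possibly with
    repetitions, since it is nonempty. *)
Lemma dot_near_star (X : topologicalType) (L : Type) (U V : set (set X))
    (x : X) :
  dot_bound X L -> is_open_cover U -> V `<=` U -> dense (\bigcup_(O in V) O) ->
  exists g : L -> set X, [/\ range g `<=` V,
    \bigcup_b g b `<=` iter_star 2 [set x] U & closure (\bigcup_b g b) x].
Proof.
move=> dL Uc VU Vd; have [Uo _] := Uc.
have [W [WV WL Wx]] := dL V (fun O VO => Uo O (VU O VO)) Vd x.
pose W' := W `&` [set O | O `&` star [set x] U !=set0].
(* [star [set x] U] is an open neighbourhood of [x], so the members of [W] that
   miss it do not matter for having [x] in the closure. *)
have W'x : closure (\bigcup_(O in W') O) x.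
  move=> B xB; have nB : nbhs x (B `&` star [set x] U).
    apply: filterI => //; apply: open_nbhs_nbhs.
    by split; [exact: open_star|exact: star_point].
  have [z [[O WO Oz] [Bz stz]]] := Wx _ nB.
  by exists z; split=> //; exists O => //; split=> //; exists z.
have [_ [O W'O _]] := closure_nonempty _ _ _ W'x.
have W'L : W' #<= [set: L].
  by apply: card_le_trans WL; apply: subset_card_le => P [].
have [g gW'] : exists g : L -> set X, range g = W'.
  by apply: card_le_range W'L; exists O.
have gE : \bigcup_b g b = \bigcup_(O in W') O by rewrite -gW' bigcup_image.
exists g; rewrite gE gW'; split=> // [P [/WV]//|z [P [WP Pst] Pz]].
by exists P => //; split=> //; exact/VU/WV.
Qed.

Lemma card_le_star_separation (X : topologicalType) (K L M : Type) :
  sDelta2_bound X K -> dot_bound X L -> wL_bound X M ->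
  [set: X] #<= [set: (K * L)%type -> M].
Proof.
move=> [U [Uc Us]] dL wM.
have [->|/set0P[x0 _]] := eqVneq [set: X] set0; first exact: card_ge0.
have enum a : exists s : M -> set X,
    range s `<=` U a /\ dense (\bigcup_(O in range s) O).
  have [V [VU VM Vd]] := wM _ (Uc a).
  have [_ [_ [O VO _]]] := Vd setT (ex_intro _ x0 Logic.I) openT.
  have [s sV] := card_le_range _ _ _ (ex_intro _ O VO) VM.
  by exists s; rewrite sV.
have [s sP] := choice enum.
have code (xa : X * K) : exists h : L -> M,
    \bigcup_b s xa.2 (h b) `<=` iter_star 2 [set xa.1] (U xa.2) /\
    closure (\bigcup_b s xa.2 (h b)) xa.1.
  have [sU sd] := sP xa.2.
  have [g [gs gst gx]] := dot_near_star _ _ _ _ xa.1 dL (Uc xa.2) sU sd.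
  have lift b : exists m, s xa.2 m = g b.
    by have [|m _ sm] := gs (g b); [exists b|exists m].
  have [h hg] := choice lift; exists h.
  by rewrite (eq_bigcupr (fun b _ => hg b)).
have [h hP] := choice code.
apply: (@inj_card_leT _ _ (fun x (ab : K * L) => h (x, ab.1) ab.2)) => x y exy.
apply: contrapT => /eqP/Us[a]; apply.
have hxy : h (x, a) = h (y, a).
  by apply/funext => b; exact: (congr1 (@^~ (a, b)) exy).
have [xst _] := hP (x, a); have [_ /= ycl] := hP (y, a).
by apply: (closure_subset xst); rewrite /= hxy.
Qed.

Theorem theorem4p3 (X : topologicalType) :
  accessible_space X -> urysohn_space X ->
  [set: X] #<= [set: (sDelta2 X * dot X)%type -> wL X].
Proof.
move=> X1 XU; have [_ sK _] := sDelta2P X1 XU.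
have [_ dL _] := dotP X; have [_ wM _] := wLP X.
exact: card_le_star_separation _ _ _ _ sK dL wM.
Qed.
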